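(* Let $(\mathcal Y,\rho_{\mathcal Y})$ be a separable metric space with its Borel $\sigma$-algebra, let $Y$ be a $\mathcal Y$-valued random variable with distribution $\mu_Y$ and support $\mathcal S$, and let $\ell:\mathcal Y\times\mathcal Y\to[0,\infty)$ be a measurable loss function. Put $R(y)=\mathbb E[\ell(Y,y)]$ for $y\in\mathcal Y$. Assume that $R$ attains its minimum over $\mathcal Y$, let $\bar m_{Fr}\in\arg\min_{y\in\mathcal Y}R(y)$ be a (selected) minimizer (Fréchet mean), and assume that $\bar m_{Fr}\in\mathcal S$. Suppose further that there are finite constants $L$ and $c$ and a constant $\alpha>0$ such that for all $y,y',y''\in\mathcal Y$, $$\ell(y,y')\le L,\qquad |\ell(y,y')-\ell(y,y'')|\le c\,\ell(y',y''),\qquad \ell(y,y')\le\rho_{\mathcal Y}(y,y')^{\alpha}.$$ Let $Y_1,Y_2,\dots$ and $Y'_1,Y'_2,\dots$ be two independent sequences of i.i.d. copies of $Y$, and for each $n\ge 1$ let $$\bar m_n\in\arg\min_{y\in\{Y'_1,\dots,Y'_n\}}\ \sum_{i=1}^n\ell(Y_i,y).$$ Then $$\lim_{n\to\infty}R(\bar m_n)=R(\bar m_{Fr})\quad\text{almost surely.}$$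
   Context: The support $\mathcal S$ of $\mu_Y$ is the set of points $y\in\mathcal Y$ all of whose open neighbourhoods have positive $\mu_Y$-measure (equivalently, since $\mathcal Y$ is separable, the smallest closed set of $\mu_Y$-measure one). The minimizer of $R$ need not be unique; $\bar m_{Fr}$ denotes one selected by some rule. Likewise $\bar m_n$ is any measurable selection among the minimizers over the finite set $\{Y'_1,\dots,Y'_n\}$. $R(\bar m_n)$ denotes the function $R$ evaluated at the random point $\bar m_n$, i.e. the expectation is taken only over a fresh copy of $Y$ independent of the data. *)

(* Defs.v *)
From HB Require Import structures.
From mathcomp Require Import all_boot all_order all_algebra finmap.
From mathcomp Require Import all_classical all_reals all_analysis.

Set Implicit Arguments.
Unset Strict Implicit.
Unset Printing Implicit Defensive.

Import Order.TTheory GRing.Theory Num.Theory.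
Import numFieldNormedType.Exports.

Local Open Scope classical_set_scope.
Local Open Scope ring_scope.

(* [measurableType] requires a distinguished point, which [metricType] does not
   provide; the distance [mdist] is the one of [metricType]. *)
#[short(type="pointedMetricType")]
HB.structure Definition PointedMetric (K : numDomainType) :=
  {M of Pointed M & Metric K M}.

Definition separable (T : topologicalType) : Prop :=
  exists2 D : set T, countable D & dense D.

Notation borel T := (g_sigma_algebraType (@open T)).

Definition measure_support (R : realType) (T : pointedMetricType R)
    (mu : set (borel T) -> \bar R) : set T :=
  [set y | forall U : set T, open_nbhs y U -> (0 < mu U)%E].

Definition argmin (d : Order.disp_t) (V : porderType d) (T : Type)
    (A : set T) (f : T -> V) : set T :=
  [set y | A y /\ forall z, A z -> (f y <= f z)%O].

Section Independence.
Local Open Scope ereal_scope.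
Context (d d' : measure_display) (Omega : measurableType d)
  (T : measurableType d') (R : realType) (P : probability Omega R).

Definition mutually_independent (X : nat -> {RV P >-> T}) : Prop :=
  forall (J : {fset nat}) (A : nat -> set T), (forall i, measurable (A i)) ->
    P (\bigcap_(i in [set` J]) (X i @^-1` A i)) =
    \prod_(i <- J) P (X i @^-1` A i).

Definition iid_copies (Y : {RV P >-> T}) (X : nat -> {RV P >-> T}) : Prop :=
  mutually_independent X /\
  forall i (A : set T), measurable A ->
    distribution P (X i) A = distribution P Y A.

Definition generated_sigma_algebra (X : nat -> {RV P >-> T}) :
    set (set Omega) :=
  <<s \bigcup_i preimage_set_system setT (X i) measurable >>.

Definition independent_sequences (X X' : nat -> {RV P >-> T}) : Prop :=
  forall A B, generated_sigma_algebra X A -> generated_sigma_algebra X' B ->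
    P (A `&` B) = P A * P B.

End Independence.

Definition risk (R : realType) (T : pointedMetricType R)
    (d : measure_display) (Omega : measurableType d) (P : probability Omega R)
    (loss : T -> T -> R) (Y : {RV P >-> borel T}) (y : T) : \bar R :=
  ('E_P[fun w => loss (Y w) y])%E.

(* Main.v *)
Require Import Defs.
From mathcomp Require Import all_boot all_order all_algebra.
From mathcomp Require Import all_classical all_reals all_analysis.
From mathcomp Require Import measurable_realfun ring lra finmap.

Import Order.TTheory GRing.Theory Num.Theory.
Import numFieldNormedType.Exports.

Local Open Scope classical_set_scope.
Local Open Scope ring_scope.

(** The candidates come from a sample independent of the data, so a union bound
over the n candidates is enough and no uniform law of large numbers over the
class of all [loss^~ y] is needed.  Cut the space into countably many cells of
small diameter.  Inside a cell the Hölder condition lets us replace the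
candidate by the fixed centre [u k] of its cell; by independence,
P(Y'_j in C_k, the empirical risk of u_k deviates) is the product of the two
probabilities, Hoeffding's inequality bounds the second factor uniformly in k,
and the first factors sum to 1.  Hence the empirical risk is close to [risk] at
all n candidates except with probability O(n q^n), and Borel-Cantelli applies.
Since [mFr] is in the support, some candidate is eventually close to it, so the
minimal empirical risk is at most [risk loss Y mFr] up to a small error. *)

Set Implicit Arguments.
Unset Strict Implicit.
Unset Printing Implicit Defensive.

(** * Hoeffding's inequality, from finite alphabets to bounded functions *)

(** Since [(1 - x) * expR x <= 1], it suffices that [(1 - x) * (1 + x + 2 * x ^+ 2) = 1 + x ^+ 2 *
    (1 - 2 * x)] be at least 1, which is where [x <= 2^-1] enters. *)
Lemma expR_le_quadratic (R : realType) (x : R) :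
  x <= 2^-1 -> expR x <= 1 + x + 2 * x ^+ 2.
Proof.
move=> x2.
have x0 : 0 < 1 - x by lra.
have /(ler_wpM2l (expR_ge0 x)) : 1 - x <= expR (- x) by have := expR_ge1Dx (- x).
rewrite expRxMexpNx_1 => h.
rewrite -(ler_pM2r x0); apply: le_trans h _; nra.
Qed.

(** Exponential Markov inequality: on the words [s] that are kept, [1 <= expR (l * (\sum_i v (s i) -
    n%:R * e))]. Summed over all words with their weights, these exponentials factor into [n] copies
    of the moment generating function of [v] under [p]. *)
Lemma chernoff_finite (R : realType) (I : finType) (p v : I -> R) (n : nat)
    (e : R) :
  (forall i, 0 <= p i) -> \sum_i p i = 1 -> \sum_i p i * v i <= 0 ->
  (forall i, `|v i| <= 1) -> 0 <= e <= 2 ->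
  \sum_(s : {ffun 'I_n -> I} | n%:R * e <= \sum_(i < n) v (s i))
     \prod_(i < n) p (s i) <= expR (- e ^+ 2 / 8) ^+ n.
Proof.
move=> p0 p1 pv0 v1 /andP[e0 e2].
(* Minimizes [2 * l ^+ 2 - l * e], with value [- e ^+ 2 / 8]; [e <= 2] gives [l <= 2^-1], as the
   quadratic bound on [expR] requires. *)
pose l := e / 4.
have mgf : \sum_i p i * expR (l * v i) <= expR (2 * l ^+ 2).
  apply: (@le_trans _ _ (\sum_i (p i + l * (p i * v i) + 2 * l ^+ 2 * p i))).
    apply: ler_sum => i _.
    have /ler_normlP[vl vr] := v1 i.
    have lv : l * v i <= 2^-1 by rewrite /l; nra.
    apply: (le_trans (ler_wpM2l (p0 i) (expR_le_quadratic lv))).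
    suff : p i * (l ^+ 2 * (v i) ^+ 2) <= p i * l ^+ 2 by lra.
    apply: ler_wpM2l => //; rewrite -[leRHS]mulr1; apply: ler_wpM2l; nra.
  (* The linear term is nonpositive because the mean of [v] is; [1 + x <= expR x] does the rest. *)
  rewrite !big_split /= -!mulr_sumr p1 mulr1.
  apply: le_trans (expR_ge1Dx _); rewrite lerD2r gerDl mulr_ge0_le0// /l; lra.
have -> : expR (- e ^+ 2 / 8) ^+ n =
    expR (- (l * (n%:R * e))) * expR (2 * l ^+ 2) ^+ n.
  rewrite -!expRM_natl -expRD; congr expR.
  by rewrite /l; field.
pose W (s : {ffun 'I_n -> I}) : R := \prod_(i < n) (p (s i) * expR (l * v (s i))).
apply: (@le_trans _ R (expR (- (l * (n%:R * e))) * \sum_s W s)).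
  rewrite mulr_sumr big_mkcond; apply: ler_sum => s _.
  rewrite /W big_split /= -expR_sum mulrCA -expRD -mulr_sumr.
  have P0 : 0 <= \prod_(i < n) p (s i) by apply: prodr_ge0.
  case: ifP => [h|_]; last by rewrite mulr_ge0 ?expR_ge0.
  rewrite -[leLHS]mulr1; apply: ler_wpM2l => //.
  rewrite -[leLHS]expR0 ler_expR addrC subr_ge0 ler_wpM2l// /l; lra.
apply: ler_wpM2l; first exact: expR_ge0.
rewrite /W -(bigA_distr_bigA (fun (_ : 'I_n) i => p i * expR (l * v i))).
rewrite prodr_const card_ord lerXn2r ?nnegrE ?expR_ge0//.
by apply: sumr_ge0 => i _; rewrite mulr_ge0 ?expR_ge0.
Qed.

(** Recasts independence, defined through finite sets of naturals, for the first [n] samples, with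
    each marginal law replaced by that of [Y]. *)
Lemma iid_bigcap (d d' : measure_display) (Omega : measurableType d)
    (T : measurableType d') (R : realType) (P : probability Omega R)
    (Y : {RV P >-> T}) (Ys : nat -> {RV P >-> T}) (n : nat)
    (A : 'I_n -> set T) :
  iid_copies Y Ys -> (forall i, measurable (A i)) ->
  P (\bigcap_(i in [set: 'I_n]) (Ys i @^-1` A i)) =
  (\prod_(i < n) P (Y @^-1` A i))%E.
Proof.
move=> [indep idistr] mA.
(* From [n] on the family is padded with the full set; [J] below never reaches those indices. *)
pose B (k : nat) := oapp A setT (insub k : option 'I_n).
have mB k : measurable (B k) by rewrite /B; case: insubP => [i _ _|_] /=.
have BE (i : 'I_n) : B i = A i by rewrite /B valK.
pose J : {fset nat} := [fset k in iota 0 n]%fset.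
have JE k : (k \in J) = (k < n)%N by rewrite in_fset /= mem_iota add0n.
have := indep J B mB.
have -> : \bigcap_(i in [set` J]) (Ys i @^-1` B i) =
    \bigcap_(i in [set: 'I_n]) (Ys i @^-1` A i).
  apply/seteqP; split=> [w h i _|w h k /=].
    by have := h i; rewrite /= JE ltn_ord BE; apply.
  by rewrite JE => kn; have := h (Ordinal kn) I; rewrite -BE.
move=> ->.
have pJ : perm_eq J (iota 0 n).
  by apply: uniq_perm; rewrite ?fset_uniq ?iota_uniq// => k; rewrite JE mem_iota.
rewrite (perm_big _ pJ) /= -[n in iota 0 n]subn0 -/(index_iota 0 n) big_mkord.
by apply: eq_bigr => i _; rewrite BE; exact: idistr.
Qed.

Lemma measure_bigsetU_le (d : measure_display) (T : measurableType d)
    (R : realType) (mu : {measure set T -> \bar R}) (I : Type) (s : seq I)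
    (Q : pred I) (F : I -> set T) :
  (forall i, measurable (F i)) ->
  (mu (\big[setU/set0]_(i <- s | Q i) F i) <= \sum_(i <- s | Q i) mu (F i))%E.
Proof.
move=> mF; elim: s => [|i s IH]; first by rewrite !big_nil measure0.
rewrite !big_cons; case: ifP => // _.
apply: (le_trans (measureU2 _ (mF i) _)); last exact: leeD2l.
by apply: bigsetU_measurable.
Qed.

Lemma sum_fine_preimage (d d' : measure_display) (Omega : measurableType d)
    (T : measurableType d') (R : realType) (P : probability Omega R)
    (Y : {RV P >-> T}) (I : finType) (k : T -> I) :
  (forall i, measurable (k @^-1` [set i])) ->
  \sum_i fine (P (Y @^-1` (k @^-1` [set i]))) = 1.
Proof.
move=> mk; apply: EFin_inj; rewrite -sumEFin -[RHS](probability_setT P).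
have mYk i : measurable (Y @^-1` (k @^-1` [set i])).
  exact: (measurable_funPTI _ (mk i)).
have -> : [set: Omega] =
    \bigcup_(i in [set` index_enum I]) (Y @^-1` (k @^-1` [set i])).
  by apply/seteqP; split=> // w _; exists (k (Y w)) => //=; exact: mem_index_enum.
rewrite measure_fin_bigcup//.
  by rewrite -fsbig_seq ?index_enum_uniq//; apply: eq_bigr => i _;
    rewrite fineK// fin_num_measure.
apply/trivIsetP => i j _ _ /eqP ij; rewrite -subset0 => w [wi wj].
exact: ij (etrans (esym wi) wj).
Qed.

(** The event is the union, over the words [s] satisfying the inequality, of the events that [k]
    reads the sample as [s]. Independence turns the probability of each into a product of weights,
    which leaves [chernoff_finite]. *)
Lemma chernoff_finite_range (d d' : measure_display) (Omega : measurableType d)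
    (T : measurableType d') (R : realType) (P : probability Omega R)
    (Y : {RV P >-> T}) (Ys : nat -> {RV P >-> T}) (I : finType) (k : T -> I)
    (v : I -> R) (n : nat) (e : R) :
  iid_copies Y Ys ->
  (forall i, measurable (k @^-1` [set i])) ->
  \sum_i fine (P (Y @^-1` (k @^-1` [set i]))) * v i <= 0 ->
  (forall i, `|v i| <= 1) -> 0 <= e <= 2 ->
  (P [set w | (n%:R * e <= \sum_(i < n) v (k (Ys i w)))%R]
    <= (expR (- e ^+ 2 / 8) ^+ n)%:E)%E.
Proof.
move=> iid mk pv0 v1 e02.
pose A i := k @^-1` [set i]; pose p i := fine (P (Y @^-1` A i)).
have mYA i : measurable (Y @^-1` A i).
  exact: (measurable_funPTI _ (mk i)).
have mYsA j i : measurable (Ys j @^-1` A i).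
  exact: (measurable_funPTI _ (mk i)).
have pE i : P (Y @^-1` A i) = (p i)%:E.
  by rewrite /p fineK ?fin_num_measure.
have p0 i : 0 <= p i by apply: fine_ge0.
have p1 : \sum_i p i = 1 by exact: sum_fine_preimage.
pose F (s : {ffun 'I_n -> I}) := \bigcap_(i in [set: 'I_n]) (Ys i @^-1` A (s i)).
have mF s : measurable (F s) by apply: fin_bigcap_measurable.
have -> : [set w | n%:R * e <= \sum_(i < n) v (k (Ys i w))] =
   \big[setU/set0]_(s : {ffun 'I_n -> I} | n%:R * e <= \sum_(i < n) v (s i)) F s.
  rewrite -bigcup_seq_cond.
  apply/seteqP; split=> [w /= h|w [s /= /andP[_ h] ws] /=].
    exists [ffun i : 'I_n => k (Ys i w)] => /=.
      by rewrite mem_index_enum; under eq_bigr do rewrite ffunE.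
    by move=> i _ /=; rewrite /A/= ffunE.
  suff -> : \sum_(i < n) v (k (Ys i w)) = \sum_(i < n) v (s i) by [].
  by apply: eq_bigr => i _; rewrite (_ : k (Ys i w) = s i)//; exact: ws.
apply: (le_trans (measure_bigsetU_le P _ _ mF)).
have -> : (\sum_(s : {ffun 'I_n -> I} | (n%:R * e <= \sum_(i < n) v (s i))%R)
    P (F s) = (\sum_(s : {ffun 'I_n -> I} | n%:R * e <= \sum_(i < n) v (s i))
     \prod_(i < n) p (s i))%:E)%E.
  rewrite -sumEFin; apply: eq_bigr => s _.
  rewrite (iid_bigcap (A := fun i => A (s i)) iid (fun i => mk (s i))).
  rewrite -[RHS]prodEFin.
  by apply: eq_bigr => i _; rewrite pE.
by rewrite lee_fin; apply: chernoff_finite.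
Qed.

(* Rounding [f] down to a multiple of 1/K leaves finitely many values, for which
   independence of events gives the joint law, so that no expectation of a
   product of random variables is needed. *)
Lemma hoeffding_upper (d d' : measure_display) (Omega : measurableType d)
    (T : measurableType d') (R : realType) (P : probability Omega R)
    (Y : {RV P >-> T}) (Ys : nat -> {RV P >-> T}) (f : T -> R) (a : R)
    (n : nat) (e : R) :
  iid_copies Y Ys -> measurable_fun [set: T] f -> (forall x, 0 <= f x <= 1) ->
  ('E_P[f \o Y] = a%:E)%E -> 0 < e <= 1 ->
  (P [set w | (n%:R * e <= \sum_(i < n) (f (Ys i w) - a))%R]
    <= (expR (- e ^+ 2 / 32) ^+ n)%:E)%E.
Proof.
move=> iid mf f01 Ef /andP[e0 e1].
have mfX (X : {RV P >-> T}) : measurable_fun [set: Omega] (f \o X).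
  exact: measurableT_comp.
(* The mesh [1/K] is at most [e / 2]: rounding uses up half of the deviation, and the finite bound
   at [e / 2] yields the exponent [- e ^+ 2 / 32]. *)
pose K := (Num.truncn (2 / e)).+1.
have K0 : 0 < K%:R :> R by rewrite ltr0n.
have Ke : K%:R^-1 <= e / 2.
  rewrite -[e / 2]invrK lef_pV2 ?posrE ?invr_gt0 ?divr_gt0//.
  by rewrite invf_div ltW// truncnS_gt.
have fK0 x : 0 <= f x * K%:R by rewrite mulr_ge0//; case/andP: (f01 x).
(* There are [K.+1] values because [f x = 1] is sent to [K]; hence [inord] never falls back on its
   default. *)
pose k x : 'I_K.+1 := inord (Num.truncn (f x * K%:R)).
have kE x i : (k x == i) = (i%:R <= f x * K%:R < i.+1%:R).
  rewrite -truncn_eq// /k -val_eqE /= inordK// ltnS -(ler_nat R).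
  apply: (@le_trans _ _ (f x * K%:R)); first by rewrite truncn_le.
  by rewrite ler_piMl//; case/andP: (f01 x).
have mk i : measurable (k @^-1` [set i]).
  have -> : k @^-1` [set i] =
      [set: T] `&` f @^-1` `[i%:R / K%:R, i.+1%:R / K%:R[%classic.
    rewrite setTI; apply/seteqP; split => x /=; rewrite in_itv/=.
      by move/eqP; rewrite kE ler_pdivrMr// ltr_pdivlMr.
    by move=> h; apply/eqP; rewrite kE -ler_pdivrMr// -ltr_pdivlMr.
  exact: mf.
pose u (i : 'I_K.+1) : R := i%:R / K%:R.
have u0 i : 0 <= u i by rewrite divr_ge0.
have u1 i : u i <= 1 by rewrite ler_pdivrMr// mul1r ler_nat -ltnS.
have uf x : u (k x) <= f x < u (k x) + e / 2.
  have := kE x (k x); rewrite eqxx => /esym/andP[h1 h2].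
  rewrite ler_pdivrMr// h1 /=; apply: (lt_le_trans (y := u (k x) + K%:R^-1)).
    by rewrite /u -(ltr_pM2r K0) mulrDl divfK ?gt_eqF// mulVf ?gt_eqF// natr1.
  by rewrite lerD2l.
pose p i := fine (P (Y @^-1` (k @^-1` [set i]))).
have mYk i : measurable (Y @^-1` (k @^-1` [set i])).
  exact: (measurable_funPTI _ (mk i)).
have p0 i : 0 <= p i by exact: fine_ge0.
have p1 : \sum_i p i = 1 by exact: sum_fine_preimage.
have a0 : 0 <= a.
  by rewrite -lee_fin -Ef; apply: expectation_ge0 => w; case/andP: (f01 (Y w)).
have a1 : a <= 1.
  rewrite -lee_fin -Ef -(expectation_cst P 1); apply: expectation_le => //.
  - by move=> w; case/andP: (f01 (Y w)).
  - by apply: aeW => w; case/andP: (f01 (Y w)).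
(* Rounding down can only lower the mean, so the values [v] below have nonpositive mean, as the
   Chernoff bound demands. The left side is the integral of a finite combination of indicators. *)
have pua : \sum_i p i * u i <= a.
  rewrite -lee_fin -Ef -sumEFin expectation.unlock.
  have -> : (\sum_i (p i * u i)%:E =
      \int[P]_w \sum_i ((u i)%:E * (\1_(Y @^-1` (k @^-1` [set i])) w)%:E))%E.
    rewrite ge0_integral_sum//.
    + apply: eq_bigr => i _; rewrite ge0_integralZl_EFin//.
      * by rewrite integral_indic// setIT muleC EFinM fineK// fin_num_measure.
      * by apply/measurable_EFinP; exact: measurable_indic.
    + move=> i; apply/measurable_EFinP; apply: measurable_funM => //.
    + by move=> i w _; rewrite mule_ge0// lee_fin.
  apply: ge0_le_integral => //.
  - by move=> w _; apply: sume_ge0 => i _; rewrite mule_ge0// lee_fin.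
  - apply: emeasurable_sum => i.
    by apply/measurable_EFinP; apply: measurable_funM.
  - by apply/measurable_EFinP; exact: mfX.
  - move=> w _.
    rewrite (bigD1 (k (Y w)))//= big1 ?adde0.
      rewrite indicE mem_set// mule1 lee_fin.
      by case/andP: (uf (Y w)).
    move=> i /eqP ik; rewrite indicE memNset ?mule0//=.
    by move=> /esym.
pose v i := u i - a.
have pv0 : \sum_i p i * v i <= 0.
  under eq_bigr do rewrite /v mulrBr.
  by rewrite big_split /= sumrN -mulr_suml p1 mul1r subr_le0.
have v1 i : `|v i| <= 1.
  have := u0 i; have := u1 i; rewrite /v ler_norml; lra.
have -> : expR (- e ^+ 2 / 32) = expR (- (e / 2) ^+ 2 / 8) :> R.
  by congr expR; field.
apply: le_trans (chernoff_finite_range n iid mk pv0 v1 _); last by lra.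
have mu (b : R) (g : T -> R) : measurable_fun [set: T] g ->
    measurable [set w | n%:R * b <= \sum_(i < n) g (Ys i w)].
  move=> mg; have -> : [set w | n%:R * b <= \sum_(i < n) g (Ys i w)] =
      [set: Omega] `&`
      (fun w => \sum_(i < n) g (Ys i w)) @^-1` `[n%:R * b, +oo[%classic.
    by rewrite setTI; apply/seteqP; split => w /=; rewrite in_itv /= andbT.
  apply: measurable_sum => // i.
  exact: measurableT_comp.
apply: le_measure.
- by apply/mem_set/(mu e (fun x => f x - a)); exact: measurable_funB.
- apply/mem_set/(mu (e / 2) (v \o k)).
  move=> _ B mB; rewrite setTI.
  have -> : (v \o k) @^-1` B = \bigcup_(i in [set i | B (v i)]) (k @^-1` [set i]).
    apply/seteqP; split=> [x Bx|x [i Bi ki]]; first by exists (k x).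
    by rewrite /= (_ : k x = i).
  by apply: fin_bigcup_measurable.
- move=> w /= h.
  suff : \sum_(i < n) (f (Ys i w) - a) <= \sum_(i < n) (v (k (Ys i w)) + e / 2).
    have -> : \sum_(i < n) (v (k (Ys i w)) + e / 2) =
        \sum_(i < n) v (k (Ys i w)) + n%:R * (e / 2).
      by rewrite big_split /= sumr_const card_ord mulr_natl.
    lra.
  apply: ler_sum => i _; have /andP[_] := uf (Ys i w); rewrite /v; lra.
Qed.

Lemma bounded_Lfun1 (d : measure_display) (Omega : measurableType d)
    (R : realType) (P : probability Omega R) (f : Omega -> R) (M : R) :
  measurable_fun [set: Omega] f -> (forall w, 0 <= f w <= M) -> f \in Lfun P 1.
Proof.
move=> mf f0M; apply/Lfun1_integrable.
apply: (le_integrable measurableT _ _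
  (finite_measure_integrable_cst P M measurableT)).
  exact/measurable_EFinP.
move=> w _ /=; rewrite lee_fin; have /andP[f0 fM] := f0M w.
by rewrite !ger0_norm// (le_trans f0).
Qed.

(** After scaling to [[0, 1]], the lower tail of [g = f / M] is the upper tail of [1 - g], which
    again lies in [[0, 1]]; the factor 2 counts the two one-sided bounds. *)
Lemma hoeffding (d d' : measure_display) (Omega : measurableType d)
    (T : measurableType d') (R : realType) (P : probability Omega R)
    (Y : {RV P >-> T}) (Ys : nat -> {RV P >-> T}) (f : T -> R) (a M : R)
    (n : nat) (e : R) :
  iid_copies Y Ys -> measurable_fun [set: T] f -> (forall x, 0 <= f x <= M) ->
  ('E_P[f \o Y] = a%:E)%E -> 0 < e <= M ->
  (P [set w | (n%:R * e <= `|\sum_(i < n) (f (Ys i w) - a)|)%R]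
    <= (2 * expR (- (e / M) ^+ 2 / 32) ^+ n)%:E)%E.
Proof.
move=> iid mf f0M Ef /andP[e0 eM].
have M0 : 0 < M by exact: lt_le_trans eM.
have mfX (X : {RV P >-> T}) : measurable_fun [set: Omega] (f \o X).
  exact: measurableT_comp.
have eM01 : 0 < e / M <= 1 by rewrite divr_gt0//= ler_pdivrMr// mul1r.
pose g x := f x / M; pose h x := 1 - g x.
have g01 x : 0 <= g x <= 1.
  by have /andP[? ?] := f0M x; rewrite divr_ge0 ?(ltW M0)//= ler_pdivrMr// mul1r.
have h01 x : 0 <= h x <= 1 by have := g01 x; rewrite /h; lra.
have mg : measurable_fun [set: T] g by exact: measurable_funM.
have mh : measurable_fun [set: T] h by exact: measurable_funB.
have Eg : ('E_P[g \o Y] = (a / M)%:E)%E.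
  have -> : g \o Y = M^-1 \o* (f \o Y) by apply/funext.
  rewrite expectationZl; first by rewrite Ef -EFinM mulrC.
  by apply: (@bounded_Lfun1 _ _ _ _ _ M) => // w; exact: f0M.
have Eh : ('E_P[h \o Y] = (1 - a / M)%:E)%E.
  have -> : h \o Y = cst 1 \- (g \o Y) by apply/funext.
  rewrite expectationB.
  - by rewrite expectation_cst Eg.
  - by apply: (@bounded_Lfun1 _ _ _ _ _ 1) => //= w; rewrite ler01 lexx.
  - apply: (@bounded_Lfun1 _ _ _ _ _ 1) => [|w]; last exact: g01.
    exact: measurableT_comp.
have mdev (X : T -> R) (b c : R) : measurable_fun [set: T] X ->
    measurable [set w | b <= \sum_(i < n) (X (Ys i w) - c)].
  move=> mX; have -> : [set w | b <= \sum_(i < n) (X (Ys i w) - c)] = [set: Omega] `&`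
      (fun w => \sum_(i < n) (X (Ys i w) - c)) @^-1` `[b, +oo[%classic.
    by rewrite setTI; apply/seteqP; split => w /=; rewrite in_itv /= andbT.
  apply: measurable_sum => // i.
  by apply: measurable_funB => //; exact: measurableT_comp.
have mD : measurable [set w | n%:R * e <= `|\sum_(i < n) (f (Ys i w) - a)|].
  have -> : [set w | n%:R * e <= `|\sum_(i < n) (f (Ys i w) - a)|] =
      [set: Omega] `&` (fun w => `|\sum_(i < n) (f (Ys i w) - a)|) @^-1`
        `[n%:R * e, +oo[%classic.
    by rewrite setTI; apply/seteqP; split => w /=; rewrite in_itv /= andbT.
  have ms : measurable_fun [set: Omega] (fun w => \sum_(i < n) (f (Ys i w) - a)).
    by apply: measurable_sum => i; apply: measurable_funB => //; exact: mfX.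
  exact: (measurableT_comp (f := @Num.norm R R)).
have Sg w :
    \sum_(i < n) (g (Ys i w) - a / M) = (\sum_(i < n) (f (Ys i w) - a)) / M.
  by rewrite mulr_suml; apply: eq_bigr => i _; rewrite mulrBl.
have Sh w : \sum_(i < n) (h (Ys i w) - (1 - a / M)) =
    - ((\sum_(i < n) (f (Ys i w) - a)) / M).
  by rewrite -Sg -sumrN; apply: eq_bigr => i _; rewrite /h; ring.
set q := expR _ ^+ n; have -> : ((2 * q)%:E = q%:E + q%:E)%E.
  by rewrite -EFinD mulr_natl mulr2n.
pose G := [set w | n%:R * (e / M) <= \sum_(i < n) (g (Ys i w) - a / M)].
pose H := [set w | n%:R * (e / M) <= \sum_(i < n) (h (Ys i w) - (1 - a / M))].
apply: (le_trans (y := P (G `|` H))).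
  apply: le_measure; [exact/mem_set| |].
    by apply/mem_set; apply: measurableU; exact: mdev.
  move=> w /=; rewrite /G /H /= Sg Sh; set S := \sum_(i < n) _ => hS.
  rewrite -mulNr !mulrA !ler_pM2r ?invr_gt0//.
  by move: hS; rewrite ler_normr => /orP.
apply: le_trans (measureU2 _ _ _) _; [exact: mdev|exact: mdev|].
apply: leeD.
  exact: (hoeffding_upper n iid mg g01 Eg eM01).
exact: (hoeffding_upper n iid mh h01 Eh eM01).
Qed.

(** * Summable tails and Borel-Cantelli *)

(** With [z = expR (- (b / 2))] the term is [n * z^n * z^n], and [n * z^n <= 2 / b] because
    [n * b / 2 <= expR (n * b / 2)]; a geometric series in [z] dominates. *)
Lemma sum_natexp_lty (R : realType) (b : R) : 0 < b ->
  (\sum_(n <oo) (n%:R * expR (- b) ^+ n)%:E < +oo)%E.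
Proof.
move=> b0; pose z : R := expR (- (b / 2)).
have z0 : 0 < z by exact: expR_gt0.
have z1 : `|z| < 1 by rewrite gtr0_norm// /z expR_lt1; lra.
have le n : n%:R * expR (- b) ^+ n <= geometric (2 / b) z n.
  have -> : expR (- b) = z * z by rewrite /z -expRD; congr expR; field.
  rewrite /geometric /= exprMn mulrA ler_wpM2r ?exprn_ge0 ?(ltW z0)//.
  have zn : z ^+ n * expR (n%:R * (b / 2)) = 1.
    by rewrite /z -expRM_natl -expRD mulrN addNr expR0.
  have := expR_ge1Dx (n%:R * (b / 2)) => h.
  have : n%:R <= 2 / b * expR (n%:R * (b / 2)).
    by rewrite mulrAC ler_pdivlMr//; lra.
  move=> hn; apply: (le_trans (ler_wpM2r (exprn_ge0 n (ltW z0)) hn)).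
  by rewrite -[leLHS]mulrA [X in _ * X]mulrC zn mulr1.
apply: (@le_lt_trans _ _ (2 / b / (1 - z))%:E); last exact: ltry.
apply: lime_le.
  apply: is_cvg_nneseries => n _ _.
  by rewrite lee_fin mulr_ge0// exprn_ge0// expR_ge0.
apply: nearW => n; rewrite sumEFin lee_fin.
apply: (@le_trans _ _ (series (geometric (2 / b) z) n)).
  by apply: ler_sum => i _; exact: le.
by apply: geometric_le_lim => //; rewrite divr_ge0// ltW.
Qed.

(** The factor [n] in the bound anticipates a union bound over [n] candidates. *)
Lemma borel_cantelli_natexp (d : measure_display) (Omega : measurableType d)
    (R : realType) (P : probability Omega R) (F : nat -> set Omega) (b C : R) :
  0 < b -> (forall n, measurable (F n)) ->
  (forall n, P (F n) <= (C * (n%:R * expR (- b) ^+ n))%:E)%E ->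
  {ae P, forall w, \forall n \near \oo, ~ F n w}.
Proof.
move=> b0 mF PF.
have le0 n : 0 <= n%:R * expR (- b) ^+ n by rewrite mulr_ge0// exprn_ge0// expR_ge0.
exists (lim_sup_set F); split.
- apply: bigcap_measurable => // k _; apply: bigcup_measurable => j _; exact: mF.
- apply: lim_sup_set_cvg0 => //.
  (* The sign of [C] is not given; its absolute value makes the dominating terms nonnegative. *)
  apply: (@le_lt_trans _ _ (\sum_(n <oo) (`|C|%:E * (n%:R * expR (- b) ^+ n)%:E))%E).
    apply: lee_nneseries => // n _; apply: (le_trans (PF n)).
    by rewrite -EFinM lee_fin ler_wpM2r// ler_norm.
  rewrite nneseriesZl; last by move=> n _; rewrite lee_fin.
  rewrite lte_mul_pinfty//.
  exact: sum_natexp_lty.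
- move=> w /= h n _; apply: contrapT => hn; apply: h.
  exists n => // k /= nk Fk; apply: hn; exists k => //.
Qed.

(** * Deviations at candidates drawn from an independent sample *)

Lemma generated_sigma_algebra_measurable (d d' : measure_display)
    (Omega : measurableType d) (T : measurableType d') (R : realType)
    (P : probability Omega R) (X : nat -> {RV P >-> T}) :
  generated_sigma_algebra X `<=` measurable.
Proof.
apply: smallest_sub; first exact: sigma_algebra_measurable.
by move=> A [i _ [B mB <-]]; apply: measurable_funP.
Qed.

(** Independence of the two samples concerns generated sigma-algebras, so the deviation event has to
    be placed in that of [X], not merely among the measurable sets. *)
Lemma generated_sigma_algebra_deviation (d d' : measure_display)
    (Omega : measurableType d) (T : measurableType d') (R : realType)
    (P : probability Omega R) (X : nat -> {RV P >-> T}) (f : T -> R) (a b : R)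
    (n : nat) :
  measurable_fun [set: T] f ->
  generated_sigma_algebra X
    [set w | b <= `|\sum_(i < n) (f (X i w) - a)|].
Proof.
move=> mf.
pose G := \bigcup_i preimage_set_system setT (X i) measurable.
(* [Omega] with the coarser sigma-algebra, for which the [X i] are measurable by construction; the
   closure properties of measurable functions then apply. *)
pose S := g_sigma_algebraType G.
have mX i : measurable_fun [set: S] (X i : S -> T).
  move=> _ B mB; apply: sub_sigma_algebra; exists i => //; exists B => //.
have ms : measurable_fun [set: S] (fun w : S => \sum_(i < n) (f (X i w) - a)).
  apply: measurable_sum => i; apply: measurable_funB => //.
  exact: (measurableT_comp mf (mX i)).
have mns : measurable_fun [set: S] (fun w : S => `|\sum_(i < n) (f (X i w) - a)|).
  exact: measurableT_comp ms.
have := mns measurableT `[b, +oo[%classic (measurable_itv _).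
rewrite setTI; congr (measurable _); apply/seteqP.
by split => w /=; rewrite in_itv /= andbT.
Qed.

(** Countably many bad events cost no more than one: only the [D k] of the cell hit by [X' j]
    counts. Independence bounds the total by [q] times the sum of the probabilities of the cells,
    and disjointness makes that sum at most 1. *)
Lemma independent_partition_le (d d' : measure_display)
    (Omega : measurableType d) (T : measurableType d') (R : realType)
    (P : probability Omega R) (X X' : nat -> {RV P >-> T}) (j : nat)
    (C : nat -> set T) (D : nat -> set Omega) (q : R) :
  independent_sequences X X' ->
  trivIset [set: nat] C -> (forall k, measurable (C k)) ->
  (forall k, generated_sigma_algebra X (D k)) ->
  (forall k, P (D k) <= q%:E)%E ->
  (P (\bigcup_k (D k `&` X' j @^-1` C k)) <= q%:E)%E.
Proof.
move=> indep tC mC gD Dq.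
have mD k : measurable (D k) by exact: generated_sigma_algebra_measurable (gD k).
have mX'C k : measurable (X' j @^-1` C k) by exact: measurable_funPTI.
have q0 : 0 <= q by rewrite -lee_fin; exact: le_trans (Dq 0%N).
have tX'C : trivIset [set: nat] (fun k => X' j @^-1` C k).
  apply/trivIsetP => k l _ _ kl; rewrite -preimage_setI.
  move/trivIsetP : tC => /(_ k l Logic.I Logic.I kl) ->.
  exact: preimage_set0.
have mDX k : measurable (D k `&` X' j @^-1` C k) by exact: measurableI.
rewrite measure_semi_bigcup//; last 2 first.
- exact: (@trivIset_setIl _ _ _ _ D tX'C).
- exact: bigcup_measurable.
apply: (@le_trans _ _ (\sum_(k <oo) (q%:E * P (X' j @^-1` C k)))%E).
  apply: lee_nneseries => // k _.
  have gC : generated_sigma_algebra X' (X' j @^-1` C k).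
    apply: sub_sigma_algebra; exists j => //; exists (C k) => //.
    by rewrite setTI.
  by have /= -> := indep _ _ (gD k) gC; rewrite lee_wpmul2r.
rewrite nneseriesZl//.
have -> : (\sum_(k <oo) P (X' j @^-1` C k) = P (\bigcup_k (X' j @^-1` C k)))%E.
  by rewrite measure_semi_bigcup//; exact: bigcup_measurable.
by rewrite -[leRHS]mule1 lee_wpmul2l// probability_le1//; exact: bigcup_measurable.
Qed.

(** Hoeffding at each fixed [f k], then averaging over the cell of one candidate, then a union bound
    over the [n] candidates: the failure probability is at most [2 * n * expR (- b) ^+ n], which is
    summable. *)
Lemma sample_deviation (d d' : measure_display) (Omega : measurableType d)
    (T : measurableType d') (R : realType) (P : probability Omega R)
    (Y : {RV P >-> T}) (X X' : nat -> {RV P >-> T}) (C : nat -> set T)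
    (f : nat -> T -> R) (a : nat -> R) (M e : R) :
  iid_copies Y X -> independent_sequences X X' ->
  trivIset [set: nat] C -> (forall k, measurable (C k)) ->
  (forall k, measurable_fun [set: T] (f k)) ->
  (forall k x, 0 <= f k x <= M) ->
  (forall k, 'E_P[f k \o Y] = (a k)%:E)%E -> 0 < e <= M ->
  {ae P, forall w, \forall n \near \oo, forall j k, (j < n)%N -> C k (X' j w) ->
    `|\sum_(i < n) (f k (X i w) - a k)| < n%:R * e}.
Proof.
move=> iid indep tC mC mf f0M Ef eM.
pose D n k := [set w | n%:R * e <= `|\sum_(i < n) (f k (X i w) - a k)|].
have gD n k : generated_sigma_algebra X (D n k).
  exact: generated_sigma_algebra_deviation.
have mD n k : measurable (D n k).
  exact: generated_sigma_algebra_measurable (gD n k).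
have mX'C j k : measurable (X' j @^-1` C k) by exact: measurable_funPTI.
pose F n := \big[setU/set0]_(j < n) \bigcup_k (D n k `&` X' j @^-1` C k).
have mDC n j : measurable (\bigcup_k (D n k `&` X' j @^-1` C k)).
  by apply: bigcup_measurable => k _; exact: measurableI.
have mF n : measurable (F n) by exact: bigsetU_measurable.
pose b := (e / M) ^+ 2 / 32.
have b0 : 0 < b.
  have /andP[e0 eM'] := eM.
  by rewrite divr_gt0// exprn_gt0// divr_gt0// (lt_le_trans e0).
have PF n : (P (F n) <= (2 * (n%:R * expR (- b) ^+ n))%:E)%E.
  apply: (le_trans (measure_bigsetU_le P _ _ (fun j : 'I_n => mDC n j))).
  apply: (@le_trans _ _ (\sum_(j < n) (2 * expR (- b) ^+ n)%:E)%E).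
    apply: lee_sum => j _; apply: (independent_partition_le j indep tC mC (gD n)) => k.
    rewrite /b -mulNr.
    exact: (hoeffding n iid (mf k) (f0M k) (Ef k) eM).
  by rewrite sumEFin lee_fin sumr_const card_ord mulrCA (mulr_natl _ n).
apply: filterS (borel_cantelli_natexp b0 mF PF) => w.
apply: filterS => n Fn j k jn Ck; rewrite ltNge; apply/negP => h; apply: Fn.
rewrite /F -(bigcup_mkord n (fun j => \bigcup_k (D n k `&` X' j @^-1` C k))).
by exists j => //; exists k.
Qed.

(** * Visits of an i.i.d. sample to a set of positive probability; comparison of means *)

(** Avoiding [B] forever implies avoiding it [n] times, which has probability [p ^+ n] with [p < 1];
    let [n] grow. *)
Lemma iid_recurrent (d d' : measure_display) (Omega : measurableType d)
    (T : measurableType d') (R : realType) (P : probability Omega R)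
    (Y : {RV P >-> T}) (X : nat -> {RV P >-> T}) (B : set T) :
  iid_copies Y X -> measurable B -> (0 < P (Y @^-1` B))%E ->
  {ae P, forall w, exists j, B (X j w)}.
Proof.
move=> iid mB PB.
have mBC : measurable (~` B) by exact: measurableC.
have mYB : measurable (Y @^-1` B) by exact: measurable_funPTI.
have mXB j : measurable (X j @^-1` ~` B) by exact: measurable_funPTI.
have mN : measurable (\bigcap_j (X j @^-1` ~` B)) by exact: bigcapT_measurable.
pose p := fine (P (Y @^-1` ~` B)).
have pE : P (Y @^-1` ~` B) = p%:E.
  by rewrite /p fineK// fin_num_measure//; exact: measurable_funPTI.
have p0 : 0 <= p by exact: fine_ge0.
have p1 : `|p| < 1.
  rewrite ger0_norm// -lte_fin -pE preimage_setC probability_setC//.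
  rewrite lte_subel_addl ?fin_num_measure//.
  by rewrite -[X in (X < _)%E]add0e lteD2rE.
exists (\bigcap_j (X j @^-1` ~` B)); split => //.
  have Np n : (P (\bigcap_j (X j @^-1` ~` B)) <= (p ^+ n)%:E)%E.
    have -> : ((p ^+ n)%:E = P (\bigcap_(i in [set: 'I_n]) (X i @^-1` ~` B)))%E.
      rewrite (iid_bigcap (A := fun=> ~` B) iid (fun=> mBC)).
      rewrite (eq_bigr (fun=> p%:E)); last by move=> i _; exact: pE.
      by rewrite prodEFin prodr_const card_ord.
    apply: le_measure.
    - exact/mem_set.
    - by apply/mem_set/fin_bigcap_measurable.
    - by move=> w h i _; exact: h.
  have := fin_num_measure P _ mN; case/fineK => PN.
  apply/eqP; rewrite eq_le measure_ge0 andbT -PN lee_fin.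
  apply: (@ler_cvg_to _ \oo _ R (fun=> fine (P (\bigcap_j (X j @^-1` ~` B))))
    (fun n => p ^+ n)).
  - exact: cvg_cst.
  - exact: cvg_expr.
  - by apply: nearW => n; rewrite -lee_fin PN.
move=> w /= h j _ /= BX; apply: h; by exists j.
Qed.

(** The common bound [M] makes both expectations finite, so [fine] loses nothing. *)
Lemma expectation_leD (d : measure_display) (Omega : measurableType d)
    (R : realType) (P : probability Omega R) (f g : Omega -> R) (M e : R) :
  measurable_fun [set: Omega] f -> measurable_fun [set: Omega] g ->
  (forall w, 0 <= f w <= M) -> (forall w, 0 <= g w <= M) -> 0 <= e ->
  (forall w, f w <= g w + e) ->
  fine ('E_P[f])%E <= fine ('E_P[g])%E + e.
Proof.
move=> mf mg f0M g0M e0 fg.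
have Lf := bounded_Lfun1 P mf f0M; have Lg := bounded_Lfun1 P mg g0M.
have Le : cst e \in Lfun P 1.
  by apply: (@bounded_Lfun1 _ _ _ _ _ e) => // w; rewrite e0 lexx.
rewrite -lee_fin EFinD !fineK ?expectation_fin_num//.
rewrite -(expectation_cst P e) -expectationD//.
apply: expectation_le => //.
- by apply: measurable_funD.
- by move=> w; case/andP: (f0M w).
- by move=> w; rewrite addr_ge0//; case/andP: (g0M w).
- by apply: aeW => w; exact: fg.
Qed.

(** * Countable partitions of a separable metric space *)

Lemma metric_ball_open (R : realType) (T : metricType R) (x : T) (r : R) :
  open (ball x r).
Proof.
rewrite openE => y; rewrite ballEmdist /= => xy; apply/nbhs_ballP.
exists (r - mdist x y) => /=; first by rewrite subr_gt0.
move=> z; rewrite !ballEmdist /= => yz.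
by rewrite (le_lt_trans (metric_triangle x y z))// -ltrBrDl.
Qed.

Lemma separable_dense_sequence (T : topologicalType) (x0 : T) :
  separable T ->
  exists u : nat -> T, dense (range u).
Proof.
move=> [D /countable_injP[f finj] dD].
(* The point of [D] numbered [k] by the injection [f], or [x0] when [k] numbers none. *)
exists (fun k => xget x0 [set x | D x /\ f x = k]) => U U0 oU.
have [x [Ux Dx]] := dD U U0 oU; exists x; split=> //; exists (f x) => //.
apply: xget_unique => // y [Dy fyx].
by apply: finj => //; exact: mem_set.
Qed.

(** Balls of radius [r] around a dense sequence cover the space; removing the earlier balls from
    each makes them disjoint and keeps every cell inside its own ball. *)
Lemma metric_partition (R : realType) (T : pointedMetricType R) (r : R) :
  separable T -> 0 < r ->
  exists (C : nat -> set (borel T)) (u : nat -> T),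
    [/\ trivIset [set: nat] C, (forall k, measurable (C k)),
        (forall x, exists k, C k x) & (forall k x, C k x -> mdist (u k) x < r)].
Proof.
move=> /(separable_dense_sequence point)[u du] r0.
pose B k : set (borel T) := ball (u k) r.
have mB k : measurable (B k) by apply: sub_sigma_algebra; exact: metric_ball_open.
exists (seqDU B), u; split.
- exact: trivIset_seqDU.
- exact: seqDU_measurable.
- move=> x; have [z [bx [k _ uz]]] : ball x r `&` range u !=set0.
    apply: du; last exact: metric_ball_open.
    by exists x; exact: ballxx.
  suff : (\bigcup_k seqDU B k) x by move=> [l _ ?]; exists l.
  rewrite -seqDU_bigcup_eq; exists k => //.
  by rewrite /B uz; exact: ball_sym.
- move=> k x Cx; have : B k x by exact: subset_seqDU Cx.
  by rewrite /B ballEmdist.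
Qed.

(** * Consistency of the sample Fréchet mean *)

Section consistency.
Context (R : realType) (T : pointedMetricType R) (d : measure_display)
  (Omega : measurableType d) (P : probability Omega R) (Y : {RV P >-> borel T})
  (loss : T -> T -> R) (mFr : T) (L c alpha : R)
  (Ys Ys' : nat -> {RV P >-> borel T}) (m : nat -> {RV P >-> borel T}).
Hypothesis sepT : separable T.
Hypothesis loss_ge0 : forall y y', 0 <= loss y y'.
Hypothesis mloss : measurable_fun [set: borel T * borel T]
    (fun p : borel T * borel T => loss p.1 p.2).
Hypothesis mFr_min : argmin [set: T] (risk loss Y) mFr.
Hypothesis mFr_supp : measure_support (distribution P Y) mFr.
Hypothesis alpha_gt0 : 0 < alpha.
Hypothesis loss_le : forall y y', loss y y' <= L.
Hypothesis loss_lip : forall y y' y'', `|loss y y' - loss y y''| <= c * loss y' y''.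
Hypothesis loss_mdist : forall y y', loss y y' <= mdist y y' `^ alpha.
Hypothesis iidYs : iid_copies Y Ys.
Hypothesis iidYs' : iid_copies Y Ys'.
Hypothesis indep : independent_sequences Ys Ys'.
Hypothesis m_argmin : forall n w, (0 < n)%N ->
    argmin [set Ys' j w | j in [set j | (j < n)%N]]
      (fun y => \sum_(i < n) loss (Ys i w) y) (m n w).

(** The maximum with 1 makes the bound positive and at least every [e <= 1], as the deviation
    estimate requires. *)
Let M := Num.max L 1.

Let M_gt0 : 0 < M. Proof. by rewrite lt_max ltr01 orbT. Qed.

Let loss_bound y y' : 0 <= loss y y' <= M.
Proof. by rewrite loss_ge0 le_max loss_le. Qed.

Let mlossr (y : T) : measurable_fun [set: borel T] (loss^~ y : borel T -> R).
Proof. exact: (measurableT_comp mloss (pair2_measurable (y : borel T))). Qed.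

Let mlossY (y : T) : measurable_fun [set: Omega] (fun w => loss (Y w) y).
Proof. exact: (measurableT_comp (mlossr y)). Qed.

Let r (y : T) : R := fine (risk loss Y y).

Let rE y : risk loss Y y = (r y)%:E.
Proof.
rewrite /r fineK// expectation_fin_num//.
by apply: (@bounded_Lfun1 _ _ _ _ _ M).
Qed.

(** The Lipschitz and Hölder conditions chain: the difference is at most [|c|] times the [alpha]-th
    power of the distance from [y] to [y'], uniformly in [x]. *)
Let loss_close e : 0 < e -> exists2 s, 0 < s &
  forall x y y', mdist y y' < s -> `|loss x y - loss x y'| <= e.
Proof.
move=> e0; have c0 : 0 < `|c| + 1 by rewrite ltr_wpDl.
(* Solves [(|c| + 1) * s^alpha = e]; the added 1 avoids a division by zero. *)
exists ((e / (`|c| + 1)) `^ alpha^-1); first by rewrite powR_gt0// divr_gt0.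
move=> x y y' yy'; apply: (le_trans (loss_lip _ _ _)).
apply: (@le_trans _ _ (`|c| * (e / (`|c| + 1)))); last first.
  by rewrite mulrCA ler_piMr ?(ltW e0)// ler_pdivrMr// mul1r lerDl.
apply: (@le_trans _ _ (`|c| * loss y y')); first by rewrite ler_wpM2r// ler_norm.
apply: ler_wpM2l => //; apply: (le_trans (loss_mdist _ _)).
have -> : e / (`|c| + 1) = ((e / (`|c| + 1)) `^ alpha^-1) `^ alpha.
  by rewrite -powRrM mulVf ?lt0r_neq0// powRr1// divr_ge0// ltW.
by apply: ge0_ler_powR; rewrite ?nnegrE ?mdist_ge0 ?powR_ge0 ?ltW.
Qed.

Let risk_close e y y' : 0 <= e -> (forall x, `|loss x y - loss x y'| <= e) ->
  `|r y - r y'| <= e.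
Proof.
move=> e0 h.
have key u v : (forall x, `|loss x u - loss x v| <= e) -> r u <= r v + e.
  move=> uv; apply: (@expectation_leD _ _ _ _ _ _ M) => // w.
  by have := uv (Y w); rewrite ler_norml; lra.
have h1 := key _ _ h; have h2 : r y' <= r y + e.
  by apply: key => x; rewrite distrC.
rewrite ler_norml; lra.
Qed.

(** The 7 counts errors of size [e]: three to pass from the risk of [m n w] to its empirical risk,
    three to pass back at a candidate [Ys' j0 w] close to [mFr], and one between the risks of that
    candidate and of [mFr]. In between, minimality of [m n w] compares the two empirical risks. *)
Let risk_near_optimal e : 0 < e <= 1 ->
  {ae P, forall w, \forall n \near \oo, r (m n w) <= r mFr + 7 * e}.
Proof.
move=> /andP[e0 e1]; have [s s0 close] := loss_close e0.
have [C [u [tC mC covC Cu]]] := metric_partition sepT s0.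
have eM : 0 < e <= M by rewrite e0 le_max e1 orbT.
have dev := sample_deviation iidYs indep tC mC (fun k => mlossr (u k))
  (fun k x => loss_bound x (u k)) (fun k => rE (u k)) eM.
have openb : open_nbhs mFr (ball mFr s).
  by split; [exact: metric_ball_open|exact: ballxx].
have mb : measurable (ball mFr s : set (borel T)).
  by apply: sub_sigma_algebra; exact: metric_ball_open.
(* The support assumption enters here: the ball has positive probability, so almost surely some
   candidate falls in it. *)
have hit := iid_recurrent iidYs' mb (mFr_supp openb).
apply: filterS2 dev hit => w dev [j0 hitj].
near=> n.
have unif j : (j < n)%N ->
    `|\sum_(i < n) loss (Ys i w) (Ys' j w) - n%:R * r (Ys' j w)| <= 3 * (n%:R * e).
  move=> jn; have [k Ck] := covC (Ys' j w); have ukj := Cu _ _ Ck.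
  have devk : `|\sum_(i < n) (loss (Ys i w) (u k) - r (u k))| < n%:R * e.
    (* [j] and [k] are generalized first: the threshold on [n] given by [dev] must not depend on
       them. *)
    by move: j k jn Ck {ukj}; near: n; exact: dev.
  have rk := risk_close (ltW e0) (fun x => close x _ _ ukj).
  (* Three errors: loss and risk at the centre instead of the candidate, and
     the deviation at the centre. *)
  have -> : \sum_(i < n) loss (Ys i w) (Ys' j w) - n%:R * r (Ys' j w) =
      \sum_(i < n) (loss (Ys i w) (u k) - r (u k)) +
      n%:R * (r (u k) - r (Ys' j w)) -
      \sum_(i < n) (loss (Ys i w) (u k) - loss (Ys i w) (Ys' j w)).
    rewrite !sumrB sumr_const card_ord (_ : r (u k) *+ n = n%:R * r (u k)); first ring.
    by rewrite (mulr_natl (r (u k)) n).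
  have lk :
      `|\sum_(i < n) (loss (Ys i w) (u k) - loss (Ys i w) (Ys' j w))| <= n%:R * e.
    apply: (le_trans (ler_norm_sum _ _ _)).
    have -> : n%:R * e = \sum_(i < n) e by rewrite sumr_const card_ord mulr_natl.
    by apply: ler_sum => i _; exact: close.
  have rkn : `|n%:R * (r (u k) - r (Ys' j w))| <= n%:R * e.
    by rewrite normrM ger0_norm// ler_wpM2l.
  apply: (le_trans (ler_normB _ _)).
  have := ler_normD (\sum_(i < n) (loss (Ys i w) (u k) - r (u k)))
    (n%:R * (r (u k) - r (Ys' j w))).
  lra.
(* [j0] was fixed before [n], so it is eventually among the first [n] indices. *)
have j0n : (j0 < n)%N by near: n; exact: nbhs_infty_gt.
have n0 : (0 < n)%N by exact: leq_ltn_trans j0n.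
have [[i0 /= i0n mi0] mmin] := m_argmin w n0.
have := mmin (Ys' j0 w); rewrite -mi0 => /(_ (ex_intro2 _ _ j0 j0n erefl)).
have := unif _ i0n; have := unif _ j0n.
rewrite !ler_norml => /andP[_ h1] /andP[h2 _] h3.
have : r mFr + e >= r (Ys' j0 w).
  move: hitj; rewrite ballEmdist /= => hitj.
  have := risk_close (ltW e0) (fun x => close x _ _ hitj).
  by rewrite ler_norml; lra.
have nR : 0 < n%:R :> R by rewrite ltr0n.
move=> h4; rewrite -(ler_pM2l nR).
have := ler_wpM2l (ltW nR) h4; lra.
Unshelve. all: by end_near.
Qed.

(** Minimality of [mFr] bounds the risk from below. From above, the errors [7 / (k + 1)] form a
    countable family, so their exceptional null sets can be united. *)
Lemma frechet_sample_consistency :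
  {ae P, forall w, risk loss Y (m n w) @[n --> \oo] --> risk loss Y mFr}.
Proof.
have opt k : {ae P, forall w, \forall n \near \oo,
    r (m n w) <= r mFr + 7 * k.+1%:R^-1}.
  by apply: risk_near_optimal; rewrite invr_gt0 ltr0n/= invf_le1// ler1n.
apply: filterS (ae_foralln opt) => w {}opt.
rewrite rE; apply: cvg_EFin; first by apply: nearW => n; rewrite rE.
apply/cvgrPdist_le => /= e e0.
have e70 : 0 < e / 7 by rewrite divr_gt0.
have [k _ ke] := near_infty_natSinv_lt (PosNum e70).
have {}ke := ke k (leqnn k); rewrite /= in ke.
near=> n.
have h : r mFr <= r (m n w) by rewrite -lee_fin -!rE; exact: mFr_min.2.
have : r (m n w) <= r mFr + 7 * k.+1%:R^-1 by near: n; exact: opt.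
move=> hn; rewrite ler0_norm ?subr_le0// opprB lerBlDl (le_trans hn)//.
by rewrite lerD2l mulrC -ler_pdivlMr// ltW.
Unshelve. all: by end_near.
Qed.

End consistency.

Unset Implicit Arguments.
Set Strict Implicit.

Theorem theorem1 (R : realType) (T : pointedMetricType R)
  (d : measure_display) (Omega : measurableType d) (P : probability Omega R)
  (Y : {RV P >-> borel T}) (loss : T -> T -> R) (mFr : T) (L c alpha : R)
  (Ys Ys' : nat -> {RV P >-> borel T}) (m : nat -> {RV P >-> borel T}) :
  separable T ->
  (forall y y', 0 <= loss y y') ->
  measurable_fun [set: borel T * borel T]
    (fun p : borel T * borel T => loss p.1 p.2) ->
  argmin [set: T] (risk loss Y) mFr ->
  measure_support (distribution P Y) mFr ->
  0 < alpha ->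
  (forall y y', loss y y' <= L) ->
  (forall y y' y'', `|loss y y' - loss y y''| <= c * loss y' y'') ->
  (forall y y', loss y y' <= mdist y y' `^ alpha) ->
  iid_copies Y Ys ->
  iid_copies Y Ys' ->
  independent_sequences Ys Ys' ->
  (* the samples are indexed from 0: the first n of them are those with i < n *)
  (forall n w, (0 < n)%N ->
    argmin [set Ys' j w | j in [set j | (j < n)%N]]
      (fun y => \sum_(i < n) loss (Ys i w) y) (m n w)) ->
  {ae P, forall w, risk loss Y (m n w) @[n --> \oo] --> risk loss Y mFr}.
Proof.
move=> sepT loss0 mloss mFr_min mFr_supp alpha0 lossL loss_lip loss_mdist.
move=> iidYs iidYs' indep m_argmin.
exact: (frechet_sample_consistency sepT loss0 mloss mFr_min mFr_supp alpha0
  lossL loss_lip loss_mdist iidYs iidYs' indep m_argmin).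
Qed.
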